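(* Let $n\ge 1$ and let $G$ be a simple graph with node set $[n]$. Then $\vartheta^+(G)\geq\hat{\vartheta}(G)$.
   Context: $[n]=\{1,\dots,n\}$; $\overline{G}$ is the complement graph of $G$, and $\mathbf{A}_{H}$ denotes the adjacency matrix of a graph $H$. $\mathbf{e}$ is the all-ones vector in $\mathbb{R}^n$, $\langle\cdot,\cdot\rangle$ is the standard (trace) inner product of matrices, $\mathbf{M}\succeq\mathbf{0}$ means that $\mathbf{M}$ is symmetric positive semidefinite, and $\mathbf{M}\ge\mathbf{0}$ means entrywise non-negativity. The projection $\vartheta$-number is $$\hat{\vartheta}(G)=\min\left\{\operatorname{tr}(\mathbf{R}) : \mathbf{R}\in\mathbb{R}^{n\times n},\ \mathbf{R}\succeq\mathbf{0},\ \mathbf{R}\mathbf{e}=\mathbf{e},\ \langle\mathbf{R},\mathbf{A}_{\overline{G}}\rangle=0,\ \mathbf{R}\ge\mathbf{0}\right\}.$$ The Szegedy number is $$\vartheta^+(G)=\min\left\{x_0 : x_0\in\mathbb{R},\ \mathbf{X}\in\mathbb{R}^{n\times n},\ \begin{pmatrix}x_0&\mathbf{e}^\top\\ \mathbf{e}&\mathbf{X}\end{pmatrix}\succeq\mathbf{0},\ \operatorname{diag}(\mathbf{X})=\mathbf{e},\ \langle\mathbf{X},\mathbf{A}_{\overline{G}}\rangle=0,\ \mathbf{X}\ge\mathbf{0}\right\}.$$ *)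

(* Defs.v *)
From HB Require Import structures.
From mathcomp Require Import all_boot all_order all_algebra.
From mathcomp Require Import boolp classical_sets reals.

Set Implicit Arguments.
Unset Strict Implicit.
Unset Printing Implicit Defensive.

Import Order.TTheory GRing.Theory Num.Theory.
Local Open Scope classical_set_scope.
Local Open Scope ring_scope.

Record simple_graph (n : nat) := SimpleGraph {
  adj :> rel 'I_n;
  adj_sym : symmetric adj;
  adj_irrefl : irreflexive adj }.

Lemma compl_sym n (G : simple_graph n) :
  symmetric (fun i j : 'I_n => (i != j) && ~~ G i j).
Proof. by move=> i j; rewrite eq_sym adj_sym. Qed.

Lemma compl_irrefl n (G : simple_graph n) :
  irreflexive (fun i j : 'I_n => (i != j) && ~~ G i j).
Proof. by move=> i; rewrite eqxx. Qed.

Definition compl_graph n (G : simple_graph n) : simple_graph n :=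
  SimpleGraph (compl_sym G) (compl_irrefl G).

Section Numbers.
Variable R : realType.

Definition adjmx n (G : simple_graph n) : 'M[R]_n :=
  \matrix_(i, j) (G i j)%:R.

Definition mxdot m n (A B : 'M[R]_(m, n)) : R := \tr (A^T *m B).

Definition psdmx n (M : 'M[R]_n) : Prop :=
  M^T = M /\ forall x : 'cV[R]_n, 0 <= (x^T *m M *m x) 0 0.

Definition nonnegmx m n (M : 'M[R]_(m, n)) : Prop :=
  forall i j, 0 <= M i j.

Definition onesv n : 'cV[R]_n := const_mx 1.

(* The least element of A (an attained minimum, not an infimum); the dummy 0 is
   returned when A has none. For n >= 1 the two sets it is applied to do have
   one: the identity matrix (with x0 = n in the second case) is feasible, and
   sublevel sets are compact. *)
Definition minset_val (A : set R) : R := xget 0 (A `&` lbound A).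

Lemma minset_valE (A : set R) (m : R) :
  A m -> lbound A m -> minset_val A = m.
Proof.
move=> Am lAm; apply: xget_unique => // y [Ay lAy].
by apply/eqP; rewrite eq_le lAm ?lAy.
Qed.

Definition projection_feasible n (G : simple_graph n) (M : 'M[R]_n) : Prop :=
  [/\ psdmx M,
      M *m onesv n = onesv n,
      mxdot M (adjmx (compl_graph G)) = 0
    & nonnegmx M].

Definition projection_theta n (G : simple_graph n) : R :=
  minset_val [set t | exists2 M, projection_feasible G M & t = \tr M].

Definition szegedy_feasible n (G : simple_graph n) (x0 : R) (X : 'M[R]_n) :
    Prop :=
  [/\ psdmx (block_mx (x0%:M : 'M_1) (onesv n)^T (onesv n) X),
      \col_i X i i = onesv n,
      mxdot X (adjmx (compl_graph G)) = 0
    & nonnegmx X].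

Definition szegedy_number n (G : simple_graph n) : R :=
  minset_val [set x0 | exists X, szegedy_feasible G x0 X].

End Numbers.

(* Main.v *)
Require Import Defs.
From HB Require Import structures.
From mathcomp Require Import all_boot all_order all_algebra.
From mathcomp Require Import boolp classical_sets reals.
From mathcomp Require Import topology normedtype derive.
From mathcomp Require Import ring lra.

Set Implicit Arguments.
Unset Strict Implicit.
Unset Printing Implicit Defensive.

Import Order.TTheory GRing.Theory Num.Theory.
Import numFieldNormedType.Exports.
Local Open Scope classical_set_scope.
Local Open Scope ring_scope.

(** The minimum defining the projection number is bounded by turning each
    point of the other program into a feasible matrix whose trace is no larger.

    Let [(x0, X)] be feasible for the Szegedy program. [X] is symmetric, has
    nonnegative entries and unit diagonal, so it can be scaled symmetrically to
    a doubly stochastic matrix: there is a positive vector [d] with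
    [d_i * (X d)_i = 1] for all [i] ([symmetric_scaling], a symmetric form of
    Sinkhorn's theorem). Then [M = D X D], with [D] the diagonal matrix of [d],
    inherits positive semidefiniteness, nonnegativity and the zero pattern of
    [X], and it fixes the all-ones vector; it is thus feasible for the
    projection program, with trace [S = sum_i d_i ^ 2]
    ([scaled_feasible]). Being symmetric and doubly stochastic, [M] satisfies
    [w^T M w <= |w| ^ 2] ([doubly_stochastic_contraction]). Testing the
    bordered positive semidefinite matrix on the vector [(-1, (d_i ^ 2)_i)]
    gives
      [0 <= x0 - 2 S + d^T M d <= x0 - 2 S + S = x0 - S],
    that is, [\tr M <= x0] ([projection_dominated]).

    The scaling vector is a maximiser of [(prod_i d_i) * (1 - d^T X d)] over the
    nonnegative [d] with [d^T X d <= 1]. At a maximiser with positive value the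
    partial derivatives vanish, which says that [2 d_i (X d)_i] is
    [1 - d^T X d] whatever [i] is; rescaling [d] makes the common value of
    [d_i (X d)_i] equal to 1.

    As both numbers are attained minima, with dummy value 0 if there were none,
    the comparison needs the minimum of the Szegedy program to exist
    ([szegedy_attained]): feasible points with [x0 <= n], seen as bordered
    matrices, form a closed set with bounded entries, hence a compact one. On
    the projection side the dummy value is harmless, since 0 is a lower bound
    of [x0]. *)

(** * Compactness for sets of matrices *)

Lemma vec_mx_continuous (R : realType) m n :
  continuous (vec_mx : 'rV[R]_(m * n) -> 'M[R]_(m, n)).
Proof.
move=> v s /= /(nbhs_ballP (vec_mx v)) [e e0 es].
apply/nbhs_ballP; exists e => //= w [_ vw]; apply: es; split=> // i j.
by rewrite !mxE; exact: vw.
Qed.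

(** Row vectors with entries in a segment form a compact set by Tychonoff's
    theorem; reshaping is continuous and carries compactness to matrices. *)
Lemma mx_closed_box_compact (R : realType) m n (a b : R)
    (A : set 'M[R]_(m, n)) :
  closed A -> (forall M, A M -> forall i j, a <= M i j <= b) -> compact A.
Proof.
move=> clA boxA.
have cB : compact [set v : 'rV[R]_(m * n) | forall k, v ord0 k \in `[a, b]].
  apply: (@rV_compact _ _ (fun=> `[a, b]%classic)) => _.
  exact: segment_compact.
have cV :=
  continuous_compact (continuous_subspaceT (@vec_mx_continuous R m n)) cB.
apply: (subclosed_compact clA cV) => M AM; exists (mxvec M); last exact: mxvecK.
by move=> k; case/mxvec_indexP: k => i j; rewrite mxvecE in_itv /=; exact: boxA.
Qed.

Lemma mx_attained_max (R : realType) m n (a b : R) (A : set 'M[R]_(m, n))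
    (f : 'M[R]_(m, n) -> R) :
  closed A -> A !=set0 -> (forall M, A M -> forall i j, a <= M i j <= b) ->
  continuous f -> exists2 M, A M & forall N, A N -> f N <= f M.
Proof.
move=> clA A0 boxA cf.
have cA := mx_closed_box_compact clA boxA.
have cNf : continuous (fun M => - f M).
  by move=> M; apply: continuousN; exact: cf.
have [M] := compact_EVT_min A0 cA (continuous_subspaceT cNf).
rewrite inE => AM minM; exists M => // N AN.
by rewrite -lerN2; apply: minM; rewrite inE.
Qed.

Lemma closed_ge0 (R : realType) (T : topologicalType) (f : T -> R) :
  continuous f -> closed [set M | 0 <= f M].
Proof.
move=> /continuous_closedP cf; apply: (cf [set x | 0 <= x]); exact: closed_ge.
Qed.

Lemma closed_level (R : realType) (T : topologicalType) (f : T -> R) c :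
  continuous f -> closed [set M | f M = c].
Proof.
move=> /continuous_closedP cf; apply: (cf [set x | x = c]); exact: closed_eq.
Qed.

Lemma closed_forall (T : topologicalType) (I : Type) (P : I -> T -> Prop) :
  (forall i, closed [set M | P i M]) -> closed [set M | forall i, P i M].
Proof.
move=> clP; rewrite (_ : [set M | _] = \bigcap_(i in setT) [set M | P i M]).
  by apply: closed_bigI => i _; exact: clP.
by apply/seteqP; split=> M /= PM i; [move=> _|]; exact: PM.
Qed.

(** * Quadratic forms *)

Section QuadraticForm.
Variables (R : realType) (n : nat).
Implicit Types (M : 'M[R]_n) (x y : 'cV[R]_n).

Definition qform M x : R := (x^T *m M *m x) 0 0.

Lemma qformE M x : qform M x = \sum_i \sum_j x i 0 * M i j * x j 0.
Proof.
rewrite /qform mxE exchange_big; apply: eq_bigr => j _ /=.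
rewrite mxE mulr_suml; apply: eq_bigr => i _; by rewrite !mxE.
Qed.

Lemma qform_mul M x : qform M x = \sum_i x i 0 * (M *m x) i 0.
Proof.
rewrite qformE; apply: eq_bigr => i _; rewrite mxE mulr_sumr.
by apply: eq_bigr => j _; rewrite mulrA.
Qed.

Lemma qform_continuous_mx x : continuous (qform^~ x).
Proof.
rewrite (_ : qform^~ x = fun M => \sum_i \sum_j x i 0 * M i j * x j 0); last first.
  by apply/funext => M; exact: qformE.
apply: continuous_big => [|i _]; first exact: add_continuous.
apply: continuous_big => [|j _]; first exact: add_continuous.
move=> M; apply: (@cvgM _ _ (nbhs M)); last exact: cvg_cst.
by apply: (@cvgM _ _ (nbhs M)); [exact: cvg_cst|exact: coord_continuous].
Qed.

Lemma qform_continuous_vec M : continuous (qform M).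
Proof.
rewrite (_ : qform M = fun x => \sum_i \sum_j x i 0 * M i j * x j 0); last first.
  by apply/funext => x; exact: qformE.
apply: continuous_big => [|i _]; first exact: add_continuous.
apply: continuous_big => [|j _]; first exact: add_continuous.
move=> x; apply: (@cvgM _ _ (nbhs x)); last exact: coord_continuous.
by apply: (@cvgM _ _ (nbhs x)); [exact: coord_continuous|exact: cvg_cst].
Qed.

Lemma qformD M x y : M^T = M ->
  qform M (x + y) = qform M x + 2 * (y^T *m M *m x) 0 0 + qform M y.
Proof.
move=> symM.
have addE (P Q : 'M[R]_1) : (P + Q) 0 0 = P 0 0 + Q 0 0 by rewrite mxE.
have yx : (x^T *m M *m y) 0 0 = (y^T *m M *m x) 0 0.
  have -> : x^T *m M *m y = (y^T *m M *m x)^T.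
    by rewrite !trmx_mul trmxK symM mulmxA.
  exact: mxE.
by rewrite /qform [(x + y)^T]linearD /= !mulmxDl !mulmxDr !addE yx; ring.
Qed.

Lemma qformZ M c x : qform M (c *: x) = c ^+ 2 * qform M x.
Proof.
have sclE a (P : 'M[R]_1) : (a *: P) 0 0 = a * P 0 0 by rewrite mxE.
rewrite /qform [(c *: x)^T]linearZ /= -scalemxAl -scalemxAl -scalemxAr !sclE.
by rewrite mulrA expr2.
Qed.

Lemma delta_form M (i j : 'I_n) :
  ((delta_mx i 0 : 'cV[R]_n)^T *m M *m (delta_mx j 0 : 'cV[R]_n)) 0 0 = M i j.
Proof. by rewrite trmx_delta -rowE -colE !mxE. Qed.

(** The form is nonnegative at [e_i - e_j]. *)
Lemma psd_entry_le M i j : psdmx M -> 2 * M i j <= M i i + M j j.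
Proof.
case=> symM psdM.
have := psdM (delta_mx i 0 + (-1) *: delta_mx j 0).
rewrite -/(qform _ _) qformD //.
rewrite qformZ [(_ *: delta_mx _ _)^T]linearZ /= -!scalemxAl mxE /qform !delta_form.
have -> : M j i = M i j by rewrite -[in LHS]symM mxE.
by lra.
Qed.

End QuadraticForm.

(** * Symmetric scaling to a doubly stochastic matrix *)

(** Fermat's rule at [h = 0] for the cubic [h K - h ^ 2 b - h ^ 3], whose
    derivative there is [K]: since [d > 0], the range of [h] contains a
    neighbourhood of 0. *)
Lemma cubic_stationary (R : realType) (d b K : R) : 0 < d -> 0 <= b ->
  (forall h, - d <= h -> h * K <= h ^+ 2 * b + h ^+ 3) -> K = 0.
Proof.
move=> d0 b0 hK; have b1 : 0 < b + 1 by lra.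
(* For h <= 1 the right-hand side is at most (b + 1) * h ^ 2, which is below
   h * K as soon as h lies strictly between 0 and 2 * t. *)
pose t := K / (2 * (b + 1)).
have tE : K = 2 * (b + 1) * t by rewrite /t; field; lra.
(* It suffices to find an admissible h that is nonzero, at most 1, and lies
   between 0 and t: then h * K dominates 2 * (b + 1) * h ^ 2. *)
suff absurd h : - d <= h -> h <= 1 -> h != 0 -> h ^+ 2 <= h * t -> K = 0.
  case: (ltgtP t 0) => [t0|t0|t0]; last by rewrite tE t0 mulr0.
  - have hE : Num.max (- d) t < 0 by rewrite gt_max t0 andbT; lra.
    apply: (absurd (Num.max (- d) t)).
    + by rewrite le_max lexx.
    + by lra.
    + by rewrite lt_eqF.
    + by rewrite expr2 ler_nM2l // le_max lexx orbT.
  - have hE : 0 < Num.min 1 t by rewrite lt_min t0 ltr01.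
    apply: (absurd (Num.min 1 t)).
    + by lra.
    + by rewrite ge_min lexx.
    + by rewrite gt_eqF.
    + by rewrite expr2 ler_pM2l // ge_min lexx orbT.
move=> hd h1 h0 ht; have := hK h hd.
have h2 : 0 < h ^+ 2 by rewrite exprn_even_gt0.
have ht2 : 2 * (b + 1) * h ^+ 2 <= h * K.
  by rewrite tE [h * _]mulrCA ler_pM2l //; lra.
have h3 : h ^+ 3 <= h ^+ 2 by rewrite exprSr ler_piMr // ltW.
by move=> hKh; exfalso; have := mulr_ge0 b0 (ltW h2); lra.
Qed.

Section Scaling.
Variables (R : realType) (n : nat) (X : 'M[R]_n).
Hypotheses (symX : X^T = X) (posX : nonnegmx X) (diagX : forall i, X i i = 1).
Implicit Type d : 'cV[R]_n.

(** The product vanishes on the boundary of [domain], so a maximiser with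
    positive value is interior and all its partial derivatives vanish; the
    second factor stands in for a Lagrange multiplier. *)
Let merit d : R := (\prod_i d i 0) * (1 - qform X d).

Let domain : set 'cV[R]_n :=
  [set d : 'cV[R]_n | (forall k, 0 <= d k 0) /\ 0 <= 1 - qform X d].

(** The term of index [(k, k)] of [qform X d] is [d_k ^ 2] and the other terms
    are nonnegative; this bounds the domain. *)
Lemma sqr_le_qform d k : (forall i, 0 <= d i 0 :> R) -> d k 0 ^+ 2 <= qform X d.
Proof.
move=> d0; rewrite qformE (bigD1 k) //= (bigD1 k) //= diagX mulr1 -expr2 -addrA.
rewrite lerDl addr_ge0 // sumr_ge0 // => i _; last rewrite sumr_ge0 // => j _.
all: by rewrite !mulr_ge0.
Qed.

Let merit_continuous : continuous merit.
Proof.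
have cq : continuous (fun d => 1 - qform X d).
  move=> d; apply: (@cvgB _ _ _ (nbhs d)); first exact: cvg_cst.
  exact: qform_continuous_vec.
have cp : continuous (fun d : 'cV[R]_n => \prod_i d i 0).
  apply: continuous_big => [|i _]; first exact: mul_continuous.
  exact: coord_continuous.
by move=> d; apply: (@cvgM _ _ (nbhs d)); [exact: cp|exact: cq].
Qed.

Let domain_closed : closed domain.
Proof.
apply: closedI.
  by apply: closed_forall => k; apply: closed_ge0; exact: coord_continuous.
apply: closed_ge0 => d.
by apply: (@cvgB _ _ _ (nbhs d)); [exact: cvg_cst|exact: qform_continuous_vec].
Qed.

Let domain_box d : domain d -> forall i j, 0 <= d i j <= 1.
Proof.
move=> [d0 q1] i j; rewrite ord1 d0 /=.
have := sqr_le_qform i d0; rewrite /= subr_ge0 in q1.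
move=> /le_trans /(_ q1); rewrite expr_le1 //.
Qed.

Let domain_merit_gt0 : exists2 d : 'cV[R]_n, domain d & 0 < merit d.
Proof.
pose q1 := qform X (const_mx 1).
have q1_ge0 : 0 <= q1.
  rewrite /q1 qformE sumr_ge0 // => i _; rewrite sumr_ge0 // => j _.
  by rewrite !mxE mul1r mulr1.
have e0 : 0 < (1 + q1)^-1 by rewrite invr_gt0; lra.
(* At this constant vector the form is q1 / (1 + q1) ^ 2 < 1. *)
pose d : 'cV[R]_n := (1 + q1)^-1 *: const_mx 1.
have dE k : d k 0 = (1 + q1)^-1 by rewrite !mxE mulr1.
have qd : 0 < 1 - qform X d.
  rewrite qformZ -/q1 subr_gt0 exprVn mulrC ltr_pdivrMr ?mul1r; last first.
    by rewrite exprn_gt0 //; lra.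
  by nra.
exists d; first by split=> [k|] /=; rewrite ?dE ltW.
by rewrite mulr_gt0 // prodr_gt0 // => k _; rewrite dE.
Qed.

(** At the maximiser, varying the coordinate [k] alone shows that the partial
    derivative of [merit] vanishes: with [s] the value of [1 - qform X d],
    [s * prod_(i != k) d_i = 2 (X d)_k * prod_i d_i]. *)
Lemma critical_point_exists : exists2 d : 'cV[R]_n, forall k, 0 < d k 0 &
  exists2 s, 0 < s & forall k, 2 * (d k 0 * (X *m d) k 0) = s.
Proof.
have [d0 Dd0 md0] := domain_merit_gt0.
have [d [d_ge0 qd] maxd] := mx_attained_max domain_closed (ex_intro _ _ Dd0)
  domain_box merit_continuous.
have md : 0 < merit d by exact: lt_le_trans (maxd _ Dd0).
have sn0 : 1 - qform X d != 0.
  by apply: contraTneq md => s0; rewrite /merit s0 mulr0 ltxx.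
have s0 : 0 < 1 - qform X d by rewrite lt0r sn0.
have pn0 : \prod_i d i 0 != 0.
  by apply: contraTneq md => p0; rewrite /merit p0 mul0r ltxx.
have d_gt0 k : 0 < d k 0.
  by move/prodf_neq0: pn0 => /(_ k isT) dk; rewrite lt0r dk d_ge0.
exists d => //; exists (1 - qform X d) => // k.
pose g := (X *m d) k 0.
have g0 : 0 <= g by rewrite /g mxE sumr_ge0 // => j _; rewrite mulr_ge0.
have sg : 1 - qform X d - 2 * (d k 0 * g) = 0.
  apply: (@cubic_stationary _ (d k 0) (2 * g + d k 0)) => //.
    by have := d_gt0 k; lra.
  move=> h hd; pose dh := d + h *: delta_mx k 0.
  have dhE i : dh i 0 = d i 0 + h *+ (i == k).
    by rewrite !mxE eqxx andbT; case: eqP => _; rewrite ?mulr1 ?mulr0.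
  have dh0 i : 0 <= dh i 0.
    rewrite dhE; case: eqP => [->|_]; last by rewrite mulr0n addr0.
    by rewrite mulr1n; lra.
  have qE : qform X dh = qform X d + 2 * h * g + h ^+ 2.
    have -> : qform X dh = qform X d +
        2 * ((h *: delta_mx k 0 : 'cV_n)^T *m X *m d) 0 0 + h ^+ 2.
      rewrite qformD // qformZ [qform X (delta_mx _ _)]delta_form.
      by rewrite diagX mulr1.
    rewrite [(h *: _)^T]linearZ /= -!scalemxAl trmx_delta -mulmxA -rowE.
    by rewrite /g; rewrite [(h *: _ : 'M_1) 0 0]mxE [row _ _ 0 0]mxE; ring.
  pose P := \prod_(i | i != k) d i 0.
  have P0 : 0 < P by rewrite prodr_gt0.
  have pd : \prod_i d i 0 = d k 0 * P by rewrite (bigD1 k).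
  have pdh : \prod_i dh i 0 = (d k 0 + h) * P.
    rewrite (bigD1 k) //= dhE eqxx mulr1n; congr (_ * _).
    by apply: eq_bigr => i /negPf ik; rewrite dhE ik addr0.
  (* Outside the domain the inequality holds because merit dh is nonpositive. *)
  have le_merit : merit dh <= merit d.
    have [qdh|qdh] := leP 0 (1 - qform X dh); first exact: maxd.
    apply: le_trans (ltW md); apply: mulr_ge0_le0; last exact: ltW.
    by rewrite prodr_ge0.
  move: le_merit; rewrite /merit pd pdh qE mulrAC [leRHS]mulrAC ler_pM2r //.
  by lra.
by move: sg => /eqP; rewrite subr_eq0 => /eqP ->.
Qed.

Lemma symmetric_scaling : exists2 d : 'cV[R]_n,
  forall k, 0 < d k 0 & forall k, d k 0 * (X *m d) k 0 = 1.
Proof.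
have [d d0 [s s0 ds]] := critical_point_exists.
pose c := Num.sqrt (2 / s).
have s2 : 0 < 2 / s by rewrite divr_gt0.
have c0 : 0 < c by rewrite sqrtr_gt0.
exists (c *: d) => k; first by rewrite mxE mulr_gt0.
have c2 : c ^+ 2 = 2 / s by rewrite sqr_sqrtr // ltW.
rewrite -scalemxAr !mxE.
rewrite (_ : c * d k 0 * _ = c ^+ 2 * (d k 0 * (X *m d) k 0)); last first.
  by rewrite mxE; ring.
by rewrite c2 -mulrA mulrCA mulrC ds; field; rewrite gt_eqF.
Qed.

End Scaling.

(** * From the Szegedy program to the projection program *)

Section SzegedyProjection.
Variables (R : realType) (n : nat) (G : simple_graph n).
Implicit Types (X M : 'M[R]_n) (v : 'cV[R]_n).

Definition bordered (x0 : R) X : 'M[R]_(1 + n) :=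
  block_mx (x0%:M : 'M_1) (onesv R n)^T (onesv R n) X.

Lemma qform_bordered x0 X a v :
  qform (bordered x0 X) (col_mx (a%:M : 'M_1) v) =
  x0 * a ^+ 2 + 2 * a * (\sum_i v i 0) + qform X v.
Proof.
set x := col_mx _ _; set Y := bordered _ _.
have xl i : x (lshift n i) 0 = a by rewrite col_mxEu ord1 mxE eqxx.
have xr i : x (rshift 1 i) 0 = v i 0 by rewrite col_mxEd.
have Yll i j : Y (lshift n i) (lshift n j) = x0.
  by rewrite block_mxEul !ord1 mxE eqxx.
have Ylr i j : Y (lshift n i) (rshift 1 j) = 1 by rewrite block_mxEur !mxE.
have Yrl i j : Y (rshift 1 i) (lshift n j) = 1 by rewrite block_mxEdl !mxE.
have Yrr i j : Y (rshift 1 i) (rshift 1 j) = X i j by rewrite block_mxEdr.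
have lE : \sum_(j < 1 + n) x (lshift n 0) 0 * Y (lshift n 0) j * x j 0 =
    x0 * a ^+ 2 + a * \sum_i v i 0.
  rewrite big_split_ord /= big_ord1 !xl Yll mulr_sumr; congr (_ + _).
    by rewrite expr2; ring.
  by apply: eq_bigr => i _; rewrite Ylr xr mulr1.
have rE i : \sum_(j < 1 + n) x (rshift 1 i) 0 * Y (rshift 1 i) j * x j 0 =
    a * v i 0 + \sum_j v i 0 * X i j * v j 0.
  rewrite big_split_ord /= big_ord1 !xr Yrl xl mulr1 mulrC; congr (_ + _).
  by apply: eq_bigr => j _; rewrite Yrr xr.
rewrite !qformE big_split_ord /= big_ord1 lE (eq_bigr _ (fun i _ => rE i)).
by rewrite big_split /= -mulr_sumr; ring.
Qed.

(** The inner product is a sum of nonnegative terms, so one linear equation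
    stands for a whole zero pattern, which diagonal scaling preserves. *)
Lemma mxdot_adjmx_eq0 (H : simple_graph n) M : nonnegmx M ->
  mxdot M (adjmx R H) = 0 <-> forall i j, H i j -> M i j = 0.
Proof.
move=> M0.
have -> : mxdot M (adjmx R H) = \sum_j \sum_i M i j * (H i j)%:R.
  apply: eq_bigr => j _; rewrite mxE; apply: eq_bigr => i _.
  by rewrite !mxE.
have t0 i j : 0 <= M i j * (H i j)%:R by rewrite mulr_ge0 ?M0.
split=> [/eqP|M_H]; last first.
  apply: big1 => j _; apply: big1 => i _.
  by case: (boolP (H i j)) => [/M_H ->|_]; rewrite (mul0r, mulr0).
rewrite psumr_eq0 => [/allP s0 i j Hij|j _]; last by rewrite sumr_ge0.
have /implyP := s0 j (mem_index_enum j); move=> /(_ isT).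
rewrite psumr_eq0 => [/allP /(_ i (mem_index_enum i))|//].
by rewrite Hij mulr1 => /eqP.
Qed.

Lemma psd_bordered x0 X : psdmx (bordered x0 X) -> psdmx X.
Proof.
case=> sym pos; split=> [|v].
  by move: sym; rewrite /bordered tr_block_mx => /eq_block_mx [_ _ _].
have := pos (col_mx (0%:M : 'M_1) v).
by rewrite -/(qform _ _) qform_bordered expr0n !mulr0 mul0r !add0r.
Qed.

(** [M] has spectral radius at most 1. Concretely,
    [2 v_i v_j <= v_i ^ 2 + v_j ^ 2] weighted by [M i j], with unit row and
    column sums. *)
Lemma doubly_stochastic_contraction M v : M^T = M -> nonnegmx M ->
  M *m onesv R n = onesv R n -> qform M v <= \sum_i v i 0 ^+ 2.
Proof.
move=> symM M0 Me.
have row1 i : \sum_j M i j = 1.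
  move/matrixP/(_ i 0): Me; rewrite !mxE => <-.
  by apply: eq_bigr => j _; rewrite !mxE mulr1.
have amgm i j : v i 0 * M i j * v j 0 <=
    2^-1 * (v i 0 ^+ 2 * M i j) + 2^-1 * (v j 0 ^+ 2 * M i j).
  by have := mulr_ge0 (M0 i j) (sqr_ge0 (v i 0 - v j 0)); lra.
rewrite qformE.
apply: (le_trans (ler_sum _ (fun i _ => ler_sum _ (fun j _ => amgm i j)))).
under eq_bigr do rewrite big_split.
rewrite big_split /= [X in _ + X]exchange_big /=.
have half :
    \sum_i \sum_j 2^-1 * (v i 0 ^+ 2 * M i j) = 2^-1 * \sum_i v i 0 ^+ 2.
  rewrite mulr_sumr; apply: eq_bigr => i _.
  by rewrite -!mulr_sumr row1 mulr1.
have -> : \sum_j \sum_i 2^-1 * (v j 0 ^+ 2 * M i j) = 2^-1 * \sum_i v i 0 ^+ 2.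
  rewrite -half; apply: eq_bigr => i _; apply: eq_bigr => j _.
  by rewrite -[in LHS]symM mxE.
by rewrite half; lra.
Qed.

Definition scaled X v : 'M[R]_n := \matrix_(i, j) (v i 0 * X i j * v j 0).

Lemma qform_scaled X v w :
  qform (scaled X v) w = qform X (\col_i (v i 0 * w i 0)).
Proof.
rewrite !qformE; apply: eq_bigr => i _; apply: eq_bigr => j _.
by rewrite !mxE; ring.
Qed.

Lemma scaled_feasible x0 X v : szegedy_feasible G x0 X ->
  (forall i, 0 <= v i 0) -> (forall i, v i 0 * (X *m v) i 0 = 1) ->
  projection_feasible G (scaled X v).
Proof.
case=> /psd_bordered [symX psdX] _ dotX X0 v0 vX.
have S0 : nonnegmx (scaled X v) by move=> i j; rewrite mxE !mulr_ge0.
split=> //.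
- split=> [|w]; last by rewrite -/(qform _ _) qform_scaled; exact: psdX.
  apply/matrixP=> i j; rewrite !mxE -[in LHS]symX mxE.
  by rewrite mulrC [v j 0 * _]mulrC mulrA.
- apply/matrixP=> i j; rewrite ord1 !mxE -[RHS](vX i) mxE mulr_sumr.
  by apply: eq_bigr => k _; rewrite !mxE mulr1 mulrA.
- apply/mxdot_adjmx_eq0 => // i j Hij.
  by rewrite mxE (proj1 (mxdot_adjmx_eq0 _ X0) dotX i j Hij) mulr0 mul0r.
Qed.

(** The test vector [(-1, (d_i ^ 2)_i)] is the choice for which the quadratic
    form of [X] becomes [d^T M d], with [M] the scaled matrix: writing
    [v_i = d_i * w_i] turns [v^T X v] into [w^T M w], here with [w = d]. *)
Lemma projection_dominated x0 X : szegedy_feasible G x0 X ->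
  exists2 M, projection_feasible G M & \tr M <= x0.
Proof.
move=> fX; have [psdY diagX _ X0] := fX.
have [symX _] := psd_bordered psdY.
have diag1 i : X i i = 1 by move/matrixP/(_ i 0): diagX; rewrite !mxE.
have [d d0 dX] := symmetric_scaling symX X0 diag1.
have fM := scaled_feasible fX (fun i => ltW (d0 i)) dX.
exists (scaled X d) => //.
have trE : \tr (scaled X d) = \sum_i d i 0 ^+ 2.
  by apply: eq_bigr => i _; rewrite mxE diag1 mulr1 expr2.
have [[symM _] Me _ M0] := fM.
have := doubly_stochastic_contraction d symM M0 Me.
have := psdY.2 (col_mx ((-1)%:M : 'M_1) (\col_i (d i 0 * d i 0))).
rewrite -/(qform _ _) qform_bordered -qform_scaled -trE.
have -> : \sum_i (\col_i (d i 0 * d i 0)) i 0 = \tr (scaled X d).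
  by rewrite trE; apply: eq_bigr => i _; rewrite mxE expr2.
by rewrite sqrrN expr1n; lra.
Qed.

(** * Attainment of the Szegedy number *)

Lemma szegedy_ge0 (x0 : R) X : szegedy_feasible G x0 X -> 0 <= x0.
Proof.
case=> -[_ /(_ (col_mx (1%:M : 'M_1) 0))].
rewrite -/(qform _ _) qform_bordered expr1n mulr1 big1 => [|i _]; last by rewrite mxE.
by rewrite /qform mulmx0 mxE mulr0 !addr0.
Qed.

(** The quadratic form of the matrix bordered with corner [n] is
    [sum_i (a + v_i) ^ 2] at [(a, v)]. *)
Lemma szegedy_feasible1 : szegedy_feasible G n%:R (1%:M : 'M[R]_n).
Proof.
have I0 : nonnegmx (1%:M : 'M[R]_n) by move=> i j; rewrite mxE ler0n.
split=> //.
- split=> [|w].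
    by rewrite tr_block_mx trmxK !tr_scalar_mx.
  rewrite -/(qform _ _) -[w]vsubmxK [usubmx w]mx11_scalar.
  set a := usubmx w 0 0; set v := dsubmx w; rewrite -/(bordered _ _).
  rewrite qform_bordered qform_mul mul1mx.
  have <- : \sum_i (a + v i 0) ^+ 2 = n%:R * a ^+ 2 + 2 * a * \sum_i v i 0 +
      \sum_i v i 0 * v i 0.
    rewrite mulr_sumr -[n in n%:R]card_ord mulr_natl -sumr_const -!big_split /=.
    by apply: eq_bigr => i _; ring.
  by rewrite sumr_ge0 // => i _; exact: sqr_ge0.
- by apply/matrixP=> i j; rewrite !mxE eqxx.
- apply/mxdot_adjmx_eq0 => // i j /=; rewrite mxE.
  by case: eqP.
Qed.

Lemma szegedy_entry_box x0 X i j : szegedy_feasible G x0 X -> 0 <= X i j <= 1.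
Proof.
case=> /psd_bordered psdX diagX _ ->.
have := psd_entry_le i j psdX.
have diag1 k : X k k = 1 by move/matrixP/(_ k 0): diagX; rewrite !mxE.
by rewrite !diag1 /=; lra.
Qed.

(** Cutting at [x0 <= n], the corner of a known feasible point, loses no
    minimiser and bounds the corner entry. *)
Let szegedy_bordered : set 'M[R]_(1 + n) :=
  [set Y | exists x0 X,
    [/\ Y = bordered x0 X, szegedy_feasible G x0 X & x0 <= n%:R]].

Let corner (Y : 'M[R]_(1 + n)) : R := Y (lshift n 0) (lshift n 0).

Lemma closed_psdmx m : closed [set M : 'M[R]_m | psdmx M].
Proof.
have -> : [set M : 'M[R]_m | psdmx M] =
    [set M : 'M[R]_m | forall ij : 'I_m * 'I_m, M ij.2 ij.1 - M ij.1 ij.2 = 0] `&`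
    [set M : 'M[R]_m | forall x, 0 <= qform M x].
  apply/seteqP; split=> M /= [symM psdM]; split=> //.
    by move=> [i j] /=; rewrite -[in X in X - _]symM mxE subrr.
  by apply/matrixP=> i j; rewrite mxE; apply/eqP; rewrite -subr_eq0 (symM (i, j)).
apply: closedI.
  apply: closed_forall => ij; apply: closed_level => M.
  by apply: (@cvgB _ _ _ (nbhs M)); exact: coord_continuous.
by apply: closed_forall => x; apply: closed_ge0; exact: qform_continuous_mx.
Qed.

Let szegedy_bordered_closed : closed szegedy_bordered.
Proof.
have -> : szegedy_bordered =
  [set Y : 'M[R]_(1 + n) | psdmx Y] `&`
  ([set Y : 'M[R]_(1 + n) | forall i, Y (rshift 1 i) (lshift n 0) = 1] `&`
  ([set Y : 'M[R]_(1 + n) | forall i, Y (rshift 1 i) (rshift 1 i) = 1] `&`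
  ([set Y : 'M[R]_(1 + n) | forall ij, compl_graph G ij.1 ij.2 ->
     Y (rshift 1 ij.1) (rshift 1 ij.2) = 0] `&`
  ([set Y : 'M[R]_(1 + n) | forall ij, 0 <= Y (rshift 1 ij.1) (rshift 1 ij.2)] `&`
   [set Y : 'M[R]_(1 + n) | 0 <= n%:R - corner Y])))).
  apply/seteqP; split=> Y.
    case=> x0 [X [-> [psdY diagX dotX X0] x0n]].
    split=> //; do 4?split=> [k|] /=.
    - by rewrite block_mxEdl mxE.
    - by rewrite block_mxEdr; move/matrixP/(_ k 0): diagX; rewrite !mxE.
    - by rewrite block_mxEdr; exact: (proj1 (mxdot_adjmx_eq0 _ X0) dotX).
    - by rewrite block_mxEdr.
    - by rewrite /corner block_mxEul mxE eqxx subr_ge0.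
  case=> /= psdY [Y1 [diagY [Y_G [Y0 Yn]]]].
  have X0 : nonnegmx (drsubmx Y) by move=> i j; rewrite !mxE; exact: (Y0 (i, j)).
  have YE : Y = bordered (corner Y) (drsubmx Y).
    rewrite -[LHS]submxK /bordered; congr block_mx.
    - by rewrite [LHS]mx11_scalar !mxE.
    - apply/matrixP=> i j; rewrite ord1 !mxE -[Y]psdY.1 mxE; exact: Y1.
    - by apply/matrixP=> i j; rewrite ord1 !mxE; exact: Y1.
  exists (corner Y), (drsubmx Y); split=> //; last by rewrite -subr_ge0.
  split=> //.
  - by rewrite -/(bordered _ _) -YE.
  - by apply/matrixP=> i j; rewrite !mxE; exact: diagY.
  - by apply/mxdot_adjmx_eq0 => // i j Hij; rewrite !mxE; exact: (Y_G (i, j)).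
apply: closedI; first exact: closed_psdmx.
apply: closedI.
  by apply: closed_forall => i; apply: closed_level; exact: coord_continuous.
apply: closedI.
  by apply: closed_forall => i; apply: closed_level; exact: coord_continuous.
apply: closedI.
  apply: closed_forall => ij; apply: closed_forall => _.
  by apply: closed_level; exact: coord_continuous.
apply: closedI.
  by apply: closed_forall => ij; apply: closed_ge0; exact: coord_continuous.
apply: closed_ge0 => Y.
by apply: (@cvgB _ _ _ (nbhs Y)); [exact: cvg_cst|exact: coord_continuous].
Qed.

Let szegedy_bordered_box Y : szegedy_bordered Y ->
  forall i j, 0 <= Y i j <= n%:R + 1.
Proof.
case=> x0 [X [-> fX x0n]] i j; have x0_ge0 := szegedy_ge0 fX.
have n0 : 0 <= n%:R :> R by rewrite ler0n.
case: (split_ordP i) => k ->; case: (split_ordP j) => l ->.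
- by rewrite block_mxEul !ord1 mxE eqxx x0_ge0 (le_trans x0n) ?lerDl.
- by rewrite block_mxEur !mxE ler01 lerDr.
- by rewrite block_mxEdl !mxE ler01 lerDr.
- rewrite block_mxEdr; have /andP[-> X1] := szegedy_entry_box k l fX.
  by rewrite (le_trans X1) ?lerDr.
Qed.

Lemma szegedy_attained : exists x0 X, szegedy_feasible G x0 X /\
  forall y0 Y, szegedy_feasible G y0 Y -> x0 <= y0.
Proof.
have ne : szegedy_bordered !=set0.
  exists (bordered n%:R 1%:M); exists n%:R, 1%:M; split=> //.
  exact: szegedy_feasible1.
have cN : continuous (fun Y => - corner Y).
  by move=> Y; apply: (@cvgN _ _ _ (nbhs Y)); exact: coord_continuous.
have [_ [x0 [X [-> fX x0n]]] maxX] :=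
  mx_attained_max szegedy_bordered_closed ne szegedy_bordered_box cN.
have cornerE y0 Y : corner (bordered y0 Y) = y0.
  by rewrite /corner block_mxEul mxE eqxx.
exists x0, X; split=> // y0 Y fY.
have [y0n|/ltW ny0] := leP y0 n%:R; last exact: le_trans ny0.
have := maxX (bordered y0 Y); rewrite !cornerE lerN2; apply.
by exists y0, Y.
Qed.

End SzegedyProjection.

(** * Comparison of the two numbers *)

Theorem theorem16 (R : realType) (n : nat) (hn : (1 <= n)%N)
  (G : simple_graph n) :
  szegedy_number R G >= projection_theta R G.
Proof.
have [x0 [X [fX minX]]] := szegedy_attained R G.
have -> : szegedy_number R G = x0.
  by apply: minset_valE => [|y [Y fY]]; [exists X|exact: minX fY].
rewrite /projection_theta /minset_val.
(* The second case is that of the dummy value 0. *)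
case: xgetP => [t _ [_ lt]|_]; last exact: szegedy_ge0 fX.
have [M fM trM] := projection_dominated fX.
by apply: le_trans trM; apply: lt; exists M.
Qed.
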